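(* For every $n \geq 1$, $\gamma(Q^3_n) \geq \gamma(Q^2_n)$.
   Context: $[n] = \{0,1,\ldots,n-1\}$. The 3D queen graph $Q^3_n$ has vertex set $[n]^3$; distinct $v,w$ are adjacent iff $w-v$ is a nonzero integer multiple of one of $(1,0,0),(0,1,0),(0,0,1)$, $(1,\pm1,0),(1,0,\pm1),(0,1,\pm1)$, $(1,\pm1,\pm1)$. The 2D queen graph $Q^2_n$ has vertex set $[n]^2$; distinct $v,w$ are adjacent iff $w-v$ is a nonzero integer multiple of one of $(1,0),(0,1),(1,1),(1,-1)$. A set $S$ of vertices of a graph is dominating if every vertex is in $S$ or adjacent to a vertex of $S$; $\gamma(G)$ is the minimum size of a dominating set of $G$. *)

(* Defs.v *)
From mathcomp Require Import all_boot all_order all_algebra.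
From mathcomp Require Import boolp.

Set Implicit Arguments.
Unset Strict Implicit.
Unset Printing Implicit Defensive.

Import GRing.Theory.

Section Domination.
Variables (T : finType) (adj : rel T).

Definition dominating (S : {set T}) : bool :=
  [forall v, (v \in S) || [exists u in S, adj v u]].

Lemma dominating_setT : dominating [set: T].
Proof. by apply/forallP => v; rewrite in_setT. Qed.

(* The starting point [set: T] is always dominating, so the minimum ranges over
   a nonempty family; see domination_numberP. *)
Definition domination_number : nat :=
  #|[arg min_(S < [set: T] | dominating S) #|S|]|.

Lemma domination_numberP :
  (exists2 S, dominating S & #|S| = domination_number) /\
  (forall S, dominating S -> domination_number <= #|S|).
Proof.
rewrite /domination_number; case: arg_minnP; first exact: dominating_setT.
by move=> S domS minS; split=> //; exists S.
Qed.

End Domination.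

Local Open Scope ring_scope.

Definition queen_move (V : zmodType) (dirs : seq V) (x y : V) : Prop :=
  exists (k : int) (d : V), [/\ k != 0, d \in dirs & y - x = d *~ k].

Definition dirs2 : seq (int * int) :=
  [:: (1, 0); (0, 1); (1, 1); (1, -1)].

Definition dirs3 : seq (int * int * int) :=
  [:: (1, 0, 0); (0, 1, 0); (0, 0, 1);
      (1, 1, 0); (1, -1, 0); (1, 0, 1); (1, 0, -1); (0, 1, 1); (0, 1, -1);
      (1, 1, 1); (1, 1, -1); (1, -1, 1); (1, -1, -1)].

Definition cell2 (n : nat) : finType := ('I_n * 'I_n)%type.
Definition cell3 (n : nat) : finType := ('I_n * 'I_n * 'I_n)%type.

Definition pos2 (n : nat) (v : cell2 n) : int * int :=
  ((v.1 : nat)%:Z, (v.2 : nat)%:Z).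

Definition pos3 (n : nat) (v : cell3 n) : int * int * int :=
  ((v.1.1 : nat)%:Z, (v.1.2 : nat)%:Z, (v.2 : nat)%:Z).

Definition queen2 (n : nat) : rel (cell2 n) := fun v w =>
  (v != w) && `[< queen_move dirs2 (pos2 v) (pos2 w) >].

Definition queen3 (n : nat) : rel (cell3 n) := fun v w =>
  (v != w) && `[< queen_move dirs3 (pos3 v) (pos3 w) >].

Lemma queen_move_sym (V : zmodType) (dirs : seq V) (x y : V) :
  queen_move dirs x y -> queen_move dirs y x.
Proof.
move=> [k [d [k0 dD e]]]; exists (- k), d; split=> //; first by rewrite oppr_eq0.
by rewrite mulrNz -e opprB.
Qed.

Lemma queen2_sym n : symmetric (@queen2 n).
Proof.
move=> v w; rewrite /queen2 eq_sym; congr (_ && _).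
by apply: asbool_equiv_eq; split; apply: queen_move_sym.
Qed.

Lemma queen3_sym n : symmetric (@queen3 n).
Proof.
move=> v w; rewrite /queen3 eq_sym; congr (_ && _).
by apply: asbool_equiv_eq; split; apply: queen_move_sym.
Qed.

(* Main.v *)
Require Import Defs.
From mathcomp Require Import all_boot all_algebra.
From mathcomp Require Import boolp.

(** Dropping the third coordinate sends every direction of a 3D queen to a
    direction of a 2D queen or to zero.  Hence the shadow of a dominating set of
    the cube dominates the square: a cell [v] is dominated by the shadow of any
    queen dominating [(v, 0)]. *)

Import GRing.Theory.

Lemma dirs3_proj (d : int * int * int) :
  d \in dirs3 -> d.1 = 0%R \/ d.1 \in dirs2.
Proof.
have /allP h : all [pred e | (e.1 == 0%R) || (e.1 \in dirs2)] dirs3 by [].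
by move=> /h /orP[/eqP ->|]; [left | right].
Qed.

Lemma pos2_inj (n : nat) : injective (@pos2 n).
Proof. by move=> [a b] [c d] [/val_inj -> /val_inj ->]. Qed.

Lemma queen3_proj (n : nat) (v w : cell3 n) :
  queen3 v w -> v.1 = w.1 \/ queen2 v.1 w.1.
Proof.
move=> /andP[_ /asboolP[k [d [k0 /dirs3_proj dD e]]]].
(* [fst] is additive, so it commutes with integer multiples, and [(pos3 w).1] is [pos2 w.1] by
   computation. *)
have {}e : (pos2 w.1 - pos2 v.1 = d.1 *~ k)%R.
  by rewrite -(raddfMz fst) -e.
have [->|vw] := eqVneq v.1 w.1; [by left | right].
rewrite /queen2 vw; apply/asboolP; exists k, d.1; split=> //.
(* A vertical move, with [d.1 = 0], would make the shadows equal, against [vw]. *)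
case: dD => // d0; move: e; rewrite d0 mul0rz => /eqP.
by rewrite subr_eq0 => /eqP /pos2_inj wv; rewrite wv eqxx in vw.
Qed.

Lemma dominating_proj (n : nat) (S : {set cell3 n}) :
  0 < n -> dominating (@queen3 n) S ->
  dominating (@queen2 n) [set w.1 | w in S].
Proof.
move=> n0 /forallP domS; apply/forallP => v.
case/orP: (domS (v, Ordinal n0)) => [vS | /exists_inP[w wS /queen3_proj /= adj_vw]].
  by apply/orP; left; apply/imsetP; exists (v, Ordinal n0).
(* A queen in the column over [v] has [v] itself as its shadow. *)
case: adj_vw => [-> | vw]; first by rewrite imset_f.
by apply/orP; right; apply/exists_inP; exists w.1; rewrite ?imset_f.
Qed.

Theorem theorem5 (n : nat) (hn : 1 <= n) :
  domination_number (@queen2 n) <= domination_number (@queen3 n).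
Proof.
have [[S domS <-] _] := domination_numberP (@queen3 n).
have [_ min2] := domination_numberP (@queen2 n).
(* Queens in one column share a shadow, so projecting can only shrink the set. *)
exact: leq_trans (min2 _ (dominating_proj n S hn domS)) (leq_imset_card _ _).
Qed.
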